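(* Let $n\ge 3$, let $K\subseteq\mathbb R^n$ be a proper cone, let $A=(a_{ij})\in\mathbb R^{n\times n}$ be a symmetric matrix, $b=(b_1,\dots,b_n)^\top\in\mathbb R^n$, $c\in\mathbb R$, and let $f:\mathbb S^n\cap\operatorname{int}(K)\to\mathbb R$ be defined by $f(x)=\langle Ax,x\rangle+\langle b,x\rangle+c$. Then the following statements hold. (i) Suppose that $A=0$. Then $f$ is spherically convex if and only if $b\in K^\perp$. (ii) Suppose that $K^*\subseteq K$ and $f$ is spherically convex. Then $$\langle Ax,y\rangle\le-\frac{\sqrt 2}{8}\langle b,x+y\rangle$$ for all $x,y\in\mathbb S^n\cap K$ with $\langle x,y\rangle=0$. In particular, if $K=\mathbb R^n_+$, then $a_{ij}\le-\frac{\sqrt2}{8}(b_i+b_j)$ for all $i,j\in[n]$ with $i\ne j$. (iii) Suppose that $f$ is spherically convex. Then $\langle b,x+y\rangle\le 0$ for all $x,y\in\mathbb S^n\cap K$ with $\langle x,y\rangle=0$. In particular, if $\mathbb R^n_+\subseteq K$ and $f$ is spherically convex, then $b_i+b_j\le 0$ for all $i,j\in[n]$ with $i\ne j$, and $$\min\{a_{ii}:i\in[n]\}\ge\max\bigl\{b_j+a_{jj}:j\in[n]\setminus\operatorname{argmin}\{a_{ii}:i\in[n]\}\bigr\},$$ where the maximum over the empty set is $-\infty$. (iv) Suppose that $f$ is spherically convex. Then $$\langle b,x+y\rangle\le-4\sqrt2\,\langle Ax,y\rangle^+$$ for all $x,y\in\mathbb S^n\cap K$ with $\langle x,y\rangle=0$.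 In particular, if $K=\mathbb R^n_+$, then $b_i+b_j\le-4\sqrt2\,a_{ij}^+$ for all $i,j\in[n]$ with $i\ne j$. (v) If $K=\mathbb R^n_+$, $A$ has positive entries and $f$ is spherically convex, then $$\|b_-\|\ge 2\left[\lambda_{\max}(A)-\lambda_{\min}(A)\right].$$ (vi) If $K\subseteq\mathbb R^n_+$ and $b_i\le 2\sqrt n\left[\lambda_{\min}(A)-\lambda_{\max}(A)\right]$ for all $i\in[n]$, then $f$ is spherically convex.
   Context: $\langle x,y\rangle=x^\top y$ is the canonical inner product on $\mathbb R^n$, $\|\cdot\|$ the Euclidean norm, and $\mathbb S^n=\{x\in\mathbb R^n:\|x\|=1\}$. $[n]=\{1,\dots,n\}$. $\mathbb R^n_+$ is the nonnegative orthant. For $\alpha\in\mathbb R$, $\alpha^+=\max(\alpha,0)$; for $b\in\mathbb R^n$, $b_-$ is the vector with components $\max(-b_i,0)$. $\lambda_{\min}(A)$, $\lambda_{\max}(A)$ are the smallest and largest eigenvalues of $A$. $\operatorname{argmin}\{a_{ii}:i\in[n]\}$ is the set of indices $i$ at which $a_{ii}$ is minimal. A set $K\subseteq\mathbb R^n$ is a proper cone if $\lambda x\in K$ for all $x\in K,\lambda>0$; $x+y\in K$ for all $x,y\in K$; there is no $x\in K\setminus\{0\}$ with $-x\in K$; $K$ is closed; and $K$ has nonempty interior $\operatorname{int}(K)$. The dual of $K$ is $K^*=\{x\in\mathbb R^n:\langle x,y\rangle\ge0\ \forall y\in K\}$ and the polar is $K^\perp=\{x\in\mathbb R^n:\langle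 x,y\rangle\le0\ \forall y\in K\}$. Geodesics of $\mathbb S^n$ are great circles (intersections of $\mathbb S^n$ with two-dimensional subspaces); a minimal geodesic segment is a shortest great-circle arc joining two points, parametrized proportionally to arc length. For a proper cone $K$, a function $f:\mathbb S^n\cap\operatorname{int}(K)\to\mathbb R$ is spherically convex if for every minimal geodesic segment $\gamma:J\to\mathbb S^n\cap\operatorname{int}(K)$ ($J$ an interval), the composition $f\circ\gamma$ is convex on $J$. *)

(* Defs.v *)
From HB Require Import structures.
From mathcomp Require Import all_boot all_order all_algebra.
From mathcomp Require Import all_classical all_reals all_analysis.
Import Order.TTheory GRing.Theory Num.Theory.
Import numFieldNormedType.Exports.

Set Implicit Arguments.
Unset Strict Implicit.
Unset Printing Implicit Defensive.

Local Open Scope classical_set_scope.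
Local Open Scope ring_scope.

Definition inner (R : realType) (n : nat) (x y : 'cV[R]_n) : R :=
  (x^T *m y) 0 0.

(* Not [`|x|]: the library norm on matrices is the max norm. *)
Definition enorm (R : realType) (n : nat) (x : 'cV[R]_n) : R :=
  Num.sqrt (inner x x).

Definition usphere (R : realType) (n : nat) : set 'cV[R]_n :=
  [set x | enorm x = 1].
Arguments usphere : clear implicits.

(* The library topology on ['cV[R]_n] is the product topology, i.e. the
   Euclidean one, so [closed K] and [K°] have their usual meaning. *)
Definition proper_cone (R : realType) (n : nat) (K : set 'cV[R]_n) : Prop :=
  (forall (x : 'cV[R]_n) (l : R), K x -> 0 < l -> K (l *: x)) /\
  (forall x y : 'cV[R]_n, K x -> K y -> K (x + y)) /\
  (forall x : 'cV[R]_n, K x -> x != 0 -> ~ K (- x)) /\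
  closed K /\
  K° !=set0.

Definition dual_cone (R : realType) (n : nat) (K : set 'cV[R]_n) :
    set 'cV[R]_n := [set x | forall y, K y -> 0 <= inner x y].

Definition polar_cone (R : realType) (n : nat) (K : set 'cV[R]_n) :
    set 'cV[R]_n := [set x | forall y, K y -> inner x y <= 0].

Definition orthant (R : realType) (n : nat) : set 'cV[R]_n :=
  [set x | forall i, 0 <= x i 0].
Arguments orthant : clear implicits.

Definition pos_part (R : realType) (a : R) : R := Num.max a 0.

Definition neg_part_vec (R : realType) (n : nat) (b : 'cV[R]_n) : 'cV[R]_n :=
  \col_i Num.max (- b i 0) 0.

(* A real symmetric matrix of positive size has finitely many, and at least one,
   eigenvalues, so this infimum and this supremum are attained.  The library's
   [eigenvalue] uses left eigenvectors, which makes no difference here. *)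
Definition lambda_min (R : realType) (n : nat) (A : 'M[R]_n) : R :=
  inf [set l | eigenvalue A l].

Definition lambda_max (R : realType) (n : nat) (A : 'M[R]_n) : R :=
  sup [set l | eigenvalue A l].

Definition argmin_diag (R : realType) (n : nat) (A : 'M[R]_n) : {set 'I_n} :=
  [set i | [forall j, A i i <= A j j]].

Definition orthonormal_pair (R : realType) (n : nat) (u v : 'cV[R]_n) : Prop :=
  [/\ enorm u = 1, enorm v = 1 & inner u v = 0].

(* The great circle cut out by the plane spanned by the orthonormal pair (u, v),
   parametrized by arc length. *)
Definition great_circle (R : realType) (n : nat) (u v : 'cV[R]_n) (t : R) :
    'cV[R]_n := cos t *: u + sin t *: v.

(* Some great-circle arc of length L goes from x to y. *)
Definition great_circle_arc (R : realType) (n : nat) (x y : 'cV[R]_n) (L : R) :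
    Prop :=
  0 <= L /\ exists u v : 'cV[R]_n,
    [/\ orthonormal_pair u v, x = great_circle u v 0 & y = great_circle u v L].

(* On the interval J, g runs along a great circle at constant speed s, and each
   of its sub-arcs is a shortest great-circle arc between its endpoints.  Only
   the values of g on J matter. *)
Definition minimal_geodesic (R : realType) (n : nat) (J : set R)
    (g : R -> 'cV[R]_n) : Prop :=
  is_interval J /\
  exists (u v : 'cV[R]_n) (a s : R),
    [/\ orthonormal_pair u v,
        0 <= s,
        (forall t, J t -> g t = great_circle u v (a + s * t)) &
        forall t1 t2, J t1 -> J t2 -> t1 <= t2 ->
          forall L, great_circle_arc (g t1) (g t2) L -> s * (t2 - t1) <= L].

(* f is total, but only its values on the sphere inside K° matter. *)
Definition spherically_convex (R : realType) (n : nat) (K : set 'cV[R]_n)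
    (f : 'cV[R]_n -> R) : Prop :=
  forall (J : set R) (g : R -> 'cV[R]_n),
    minimal_geodesic J g ->
    g @` J `<=` usphere R n `&` K° ->
    convex_function (J : set R^o) (f \o g).

(* Main.v *)
Require Import Defs.
From HB Require Import structures.
From mathcomp Require Import all_boot all_order all_algebra.
From mathcomp Require Import all_classical all_reals all_analysis.
From mathcomp Require Import ring lra.
Import Order.TTheory GRing.Theory Num.Theory.
Import numFieldNormedType.Exports.
Local Open Scope classical_set_scope.
Local Open Scope ring_scope.

(** A function on the sphere is spherically convex when its second derivative
    along unit-speed great circles is nonnegative. For
    [f x = <Ax,x> + <b,x> + c], at a point [x] and a unit tangent vector [v]
    (a unit vector orthogonal to [x]), this second derivative is
    [2 (<Av,v> - <Ax,x>) - <b,x>], because the curve accelerates towards the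
    centre. So convexity is equivalent to the inequality
    [<b,x> <= 2 (<Av,v> - <Ax,x>)] for orthogonal unit vectors [x] and [v] with
    [x] interior to [K] ([tangent_inequality_convex] and
    [convex_tangent_inequality]); by continuity it then holds for all [x] in [K]
    ([tangent_inequality_closure]). Every item is a choice of [x] and [v] in
    this inequality.

    For [A = 0] it says that [<b,x>] is nonpositive on [K]. Adding its instances
    at [(x, y)] and [(y, x)] cancels [A] and leaves [<b,x+y> <= 0]
    ([tangent_inequality_sum]). Taking the bisectors [(x + y) / sqrt 2] and
    [(x - y) / sqrt 2] leaves only the cross term [<Ax,y>]
    ([tangent_inequality_diagonal]); this gives (iv), and (ii) is the same bound
    solved for [<Ax,y>]. The entrywise statements are the case of basis vectors.

    For the bounds on eigenvalues, compactness of the sphere shows that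
    [lambda_max A] and [lambda_min A] are the extreme values of the Rayleigh
    quotient and are attained at eigenvectors ([lambda_maxP], [lambda_minP]). If
    [A] has nonnegative entries, the vector of absolute values of a top
    eigenvector still maximizes the quotient, hence is a top eigenvector in the
    orthant; with an eigenvector for [lambda_min A] as tangent vector this gives
    (v). For (vi) the quotient bounds reduce the inequality to
    [<b,x> <= 2 (lambda_min A - lambda_max A)], which follows from the bound on
    the entries of [b] because the coordinates of a nonnegative unit vector add
    up to at least 1. *)

(** * The inner product *)

Section Inner.
Context {R : realType} {n : nat}.
Implicit Types (x y z b : 'cV[R]_n) (k : R) (A : 'M[R]_n).

Lemma innerE x y : inner x y = \sum_i x i 0 * y i 0.
Proof. by rewrite /inner mxE; apply: eq_bigr => i _; rewrite mxE. Qed.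

Lemma innerC x y : inner x y = inner y x.
Proof. by rewrite !innerE; apply: eq_bigr => i _; rewrite mulrC. Qed.

Lemma innerDl x y z : inner (x + y) z = inner x z + inner y z.
Proof. by rewrite /inner linearD mulmxDl mxE. Qed.

Lemma innerZl k x y : inner (k *: x) y = k * inner x y.
Proof. by rewrite /inner linearZ -scalemxAl mxE. Qed.

Lemma inner0l x : inner 0 x = 0.
Proof. by rewrite -(scale0r 0) innerZl mul0r. Qed.

Lemma innerDr x y z : inner x (y + z) = inner x y + inner x z.
Proof. by rewrite innerC innerDl !(innerC x). Qed.

Lemma innerZr k x y : inner x (k *: y) = k * inner x y.
Proof. by rewrite innerC innerZl innerC. Qed.

Lemma innerNl x y : inner (- x) y = - inner x y.
Proof. by rewrite -scaleN1r innerZl mulN1r. Qed.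

Lemma innerNr x y : inner x (- y) = - inner x y.
Proof. by rewrite innerC innerNl innerC. Qed.

Lemma inner_mulmx_sym {A} : A^T = A ->
  forall x y, inner (A *m x) y = inner (A *m y) x.
Proof.
by move=> As x y; rewrite [RHS]innerC /inner trmx_mul As mulmxA.
Qed.

Lemma inner_ge0 x : 0 <= inner x x.
Proof. by rewrite innerE sumr_ge0 // => i _; rewrite -expr2 sqr_ge0. Qed.

Lemma inner_eq0 x : inner x x = 0 -> x = 0.
Proof.
move=> x0; apply/matrixP => i j; rewrite (ord1 j) mxE.
have /psumr_eq0P/(_ _ i isT)/eqP : forall k : 'I_n, true -> 0 <= x k 0 * x k 0.
  by move=> k _; rewrite -expr2 sqr_ge0.
by rewrite mulf_eq0 orbb -innerE x0 => /(_ erefl)/eqP.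
Qed.

Lemma inner_gt0 x : x != 0 -> 0 < inner x x.
Proof.
move=> x0; rewrite lt_neqAle inner_ge0 andbT eq_sym.
by apply: contra_neq x0 => /inner_eq0.
Qed.

Lemma enorm_eq1 x : enorm x = 1 <-> inner x x = 1.
Proof.
rewrite /enorm; split=> [h|->]; last by rewrite sqrtr1.
by rewrite -[LHS]sqr_sqrtr ?inner_ge0// h expr1n.
Qed.

Lemma normalize_enorm x : x != 0 -> enorm ((enorm x)^-1 *: x) = 1.
Proof.
move=> /inner_gt0 xx; apply/enorm_eq1.
rewrite innerZl innerZr -[inner x x]sqr_sqrtr ?ltW//.
by rewrite -/(enorm x) expr2 mulKf ?mulVf// /enorm gt_eqF// sqrtr_gt0.
Qed.

(** Cauchy-Schwarz against a unit vector [x]: expand the squared norm of the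
    component of [y] orthogonal to [x]. *)
Lemma inner_le_enorm x y : enorm x = 1 -> inner y x <= enorm y.
Proof.
move=> /enorm_eq1 x1; apply: le_trans (ler_norm _) _.
rewrite -sqrtr_sqr ler_sqrt ?inner_ge0//.
have := inner_ge0 (y - inner y x *: x).
rewrite !(innerDl, innerDr, innerNl, innerNr, innerZl, innerZr) x1 (innerC x y).
lra.
Qed.

Lemma inner_delta x (i : 'I_n) : inner x (delta_mx i 0) = x i 0.
Proof.
rewrite innerE (bigD1 i)//= big1 => [|j ji]; rewrite mxE eqxx ?mulr1 ?addr0//.
by rewrite (negbTE ji) mulr0.
Qed.

Lemma enorm_delta (i : 'I_n) : enorm (delta_mx i 0 : 'cV[R]_n) = 1.
Proof. by apply/enorm_eq1; rewrite inner_delta mxE !eqxx. Qed.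

Lemma sqr_coord_le x (i : 'I_n) : x i 0 * x i 0 <= inner x x.
Proof.
rewrite innerE (bigD1 i)//= lerDl sumr_ge0// => j _.
by rewrite -expr2 sqr_ge0.
Qed.

(** The witness is a normalized [x_j e_i - x_i e_j] with [x_i != 0]. *)
Lemma exists_unit_orthogonal x : (1 < n)%N -> enorm x = 1 ->
  exists2 v, enorm v = 1 & inner x v = 0.
Proof.
move=> n1 /enorm_eq1 xx.
pose i0 := Ordinal (ltnW n1); pose i1 := Ordinal n1.
have [[i xi]|x0] := pselect (exists i, x i 0 != 0); last first.
  have /eqP := xx; rewrite innerE big1 ?(eq_sym 0) ?oner_eq0// => i _.
  have [->|xi] := eqVneq (x i 0) 0; first by rewrite mul0r.
  by case: x0; exists i.
pose j := if i == i0 then i1 else i0.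
have ji : j != i by rewrite /j; case: (eqVneq i i0) => [->//|]; rewrite eq_sym.
pose w : 'cV[R]_n := x j 0 *: delta_mx i 0 - x i 0 *: delta_mx j 0.
have xw : inner x w = 0.
  by rewrite /w innerDr innerNr !innerZr !inner_delta mulrC subrr.
have w0 : w != 0.
  apply: contra_neq xi => w0; have := congr1 (fun M : 'cV[R]_n => M j 0) w0.
  rewrite !mxE !eqxx (negbTE ji) mulr0 add0r mulr1 => /eqP.
  by rewrite oppr_eq0 => /eqP.
exists ((enorm w)^-1 *: w); first exact: normalize_enorm.
by rewrite innerZr xw mulr0.
Qed.

End Inner.

(** * Trigonometric polynomials of degree two *)

(** The general shape of [<Ax,x> + <b,x>] read along a great circle that is run
    at speed [s] from angle [a]. This family is stable under derivation. *)
Definition trig_quad {R : realType} (a s k0 k1 k2 l0 l1 t : R) : R :=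
  let c := cos (a + s * t) in let z := sin (a + s * t) in
  k0 * (c * c) + k1 * (c * z) + k2 * (z * z) + l0 * c + l1 * z.

Lemma is_derive_trig_quad {R : realType} (a s k0 k1 k2 l0 l1 t : R) :
  is_derive t 1 (trig_quad a s k0 k1 k2 l0 l1)
    (trig_quad a s (s * k1) (2 * s * (k2 - k0)) (- (s * k1))
      (s * l1) (- (s * l0)) t).
Proof.
pose h (x : R) : R := a + s * x.
have dh : is_derive t 1 h s.
  rewrite (_ : h = cst a + s \*: id); last by apply/funext.
  by apply: is_derive_eq; rewrite add0r [LHS]mulr1.
pose C : R -> R := cos \o h; pose Z : R -> R := sin \o h.
have dC : is_derive t 1 C (- sin (h t) * s) by exact: is_derive1_comp.
have dZ : is_derive t 1 Z (cos (h t) * s) by exact: is_derive1_comp.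
rewrite (_ : trig_quad _ _ _ _ _ _ _ = k0 \*: (C * C) + k1 \*: (C * Z)
  + k2 \*: (Z * Z) + l0 \*: C + l1 \*: Z); last by apply/funext.
apply: is_derive_eq.
rewrite /trig_quad -/(h t) /C /Z /= /GRing.scale /=; ring.
Qed.

Lemma derive_trig_quad {R : realType} (a s k0 k1 k2 l0 l1 : R) :
  'D_1 (trig_quad a s k0 k1 k2 l0 l1) =
    trig_quad a s (s * k1) (2 * s * (k2 - k0)) (- (s * k1))
      (s * l1) (- (s * l0)).
Proof.
apply/funext => t.
exact: (@derive_val _ _ _ _ _ _ _
  (is_derive_trig_quad _ _ _ _ _ _ _ _)).
Qed.

Lemma derive2_trig_quad {R : realType} (a s k0 k1 k2 l0 l1 t : R) :
  'D_1 ('D_1 (trig_quad a s k0 k1 k2 l0 l1)) t =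
    s ^+ 2 * trig_quad a s (2 * (k2 - k0)) (- 4 * k1) (- 2 * (k2 - k0))
      (- l0) (- l1) t.
Proof.
rewrite derive_trig_quad.
have -> := congr1 (fun F : R -> R => F t)
  (derive_trig_quad a s (s * k1) (2 * s * (k2 - k0)) (- (s * k1))
    (s * l1) (- (s * l0))).
rewrite /trig_quad; ring.
Qed.

Lemma cvg_trig_quad {R : realType} (a s k0 k1 k2 l0 l1 t : R) :
  trig_quad a s k0 k1 k2 l0 l1 x @[x --> t] --> trig_quad a s k0 k1 k2 l0 l1 t.
Proof.
apply: differentiable_continuous; apply/derivable1_diffP.
by have [] := is_derive_trig_quad a s k0 k1 k2 l0 l1 t.
Qed.

Lemma trig_quad_convex {R : realType} (a s k0 k1 k2 l0 l1 x y : R)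
    (t : {i01 R}) :
  (forall z, x <= z <= y ->
     0 <= ('D_1 ('D_1 (trig_quad a s k0 k1 k2 l0 l1 : R -> R^o))) z) ->
  x <= y ->
  trig_quad a s k0 k1 k2 l0 l1 (conv t (x : R^o) y) <=
    conv t (trig_quad a s k0 k1 k2 l0 l1 x : R^o)
      (trig_quad a s k0 k1 k2 l0 l1 y).
Proof.
move=> h; apply: second_derivative_convex.
- by move=> z /andP[/ltW xz /ltW zy]; apply: h; rewrite xz.
- exact/cvg_at_left_filter/cvg_trig_quad.
- exact/cvg_at_right_filter/cvg_trig_quad.
- by move=> z _; have [] := is_derive_trig_quad a s k0 k1 k2 l0 l1 z.
- move=> z _; rewrite derive_trig_quad.
  by have [] := is_derive_trig_quad a s (s * k1) (2 * s * (k2 - k0))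
    (- (s * k1)) (s * l1) (- (s * l0)) z.
Qed.

Lemma half01 {R : realType} :
  exists t : {i01 R}, forall x y : R^o, conv t x y = (x + y) / 2 :> R.
Proof.
have h0 : 0 <= 2^-1 :> R by lra.
have h1 : 2^-1 <= 1 :> R by lra.
exists (Itv01 h0 h1) => x y; rewrite convRE /= /unstable.onem; lra.
Qed.

(** * Convexity along great circles *)

Section Geometry.
Context {R : realType} {n : nat}.
Implicit Types (x y z u v b : 'cV[R]_n) (k : R) (A : 'M[R]_n).

Lemma inner_great_circle u v t1 t2 : orthonormal_pair u v ->
  inner (great_circle u v t1) (great_circle u v t2) = cos (t2 - t1).
Proof.
case=> /enorm_eq1 uu /enorm_eq1 vv uv; rewrite cosB /great_circle.
rewrite !(innerDl, innerDr, innerZl, innerZr) uu vv (innerC v u) uv; ring.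
Qed.

Lemma enorm_great_circle u v t : orthonormal_pair u v ->
  enorm (great_circle u v t) = 1.
Proof.
by move=> uv; apply/enorm_eq1; rewrite inner_great_circle// subrr cos0.
Qed.

(** The velocity of an arc-length parametrization is the point a quarter turn
    ahead; this is how tangent vectors are written below. *)
Lemma inner_great_circle_tangent u v t : orthonormal_pair u v ->
  inner (great_circle u v t) (great_circle u v (t + pi / 2)) = 0.
Proof. by move=> uv; rewrite inner_great_circle// addrC addKr cos_pihalf. Qed.

Lemma great_circle0 u v : great_circle u v 0 = u.
Proof. by rewrite /great_circle cos0 sin0 scale1r scale0r addr0. Qed.

(** An arc of length [L] between points at angle [t2 - t1] satisfies
    [cos L = cos (t2 - t1)], and the cosine is injective on [[0, pi]]. *)
Lemma great_circle_minimal u v t1 t2 L : orthonormal_pair u v ->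
  0 <= t2 - t1 <= pi ->
  great_circle_arc (great_circle u v t1) (great_circle u v t2) L ->
  t2 - t1 <= L.
Proof.
move=> uv /andP[d0 dpi] [L0 [u' [v' [uv' e1 e2]]]].
rewrite leNgt; apply/negP => Ld.
have := inner_great_circle _ _ t1 t2 uv.
rewrite e1 e2 inner_great_circle// subr0 => cosE.
have : L = t2 - t1.
  apply: cos_inj => //; rewrite in_itv/= ?d0 ?dpi// L0/=.
  exact: le_trans (ltW Ld) dpi.
by move=> LE; rewrite LE ltxx in Ld.
Qed.

Lemma cvg_great_circle0 u v : great_circle u v t @[t --> (0 : R)] --> u.
Proof.
rewrite -[X in _ --> X](great_circle0 u v); apply: cvgD; apply: cvgZr_tmp.
  exact: continuous_cos.
exact: continuous_sin.
Qed.

Lemma quadratic_great_circle A b u v a s t : A^T = A ->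
  let x := great_circle u v (a + s * t) in
  inner (A *m x) x + inner b x =
  trig_quad a s (inner (A *m u) u) (2 * inner (A *m u) v) (inner (A *m v) v)
    (inner b u) (inner b v) t.
Proof.
move=> As; rewrite /trig_quad /great_circle /= mulmxDr -!scalemxAr.
rewrite !(innerDl, innerDr, innerZl, innerZr) (inner_mulmx_sym As v u); ring.
Qed.

(** At the point [x] with unit tangent vector [w], the second derivative of
    [<Ax,x> + <b,x>] with respect to arc length is
    [2 (<Aw,w> - <Ax,x>) - <b,x>]: the acceleration of the curve is [- x], and it
    contributes the two negative terms. *)
Lemma second_derive_great_circle A b u v a s t : A^T = A ->
  let x := great_circle u v (a + s * t) in
  let w := great_circle u v (a + s * t + pi / 2) in
  'D_1 ('D_1 (trig_quad a s (inner (A *m u) u) (2 * inner (A *m u) v)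
    (inner (A *m v) v) (inner b u) (inner b v))) t =
  s ^+ 2 * (2 * (inner (A *m w) w - inner (A *m x) x) - inner b x).
Proof.
move=> As; rewrite derive2_trig_quad /trig_quad /great_circle /=.
rewrite cosDpihalf sinDpihalf !mulmxDr -!scalemxAr.
rewrite !(innerDl, innerDr, innerZl, innerZr) (inner_mulmx_sym As v u); ring.
Qed.

(** Nonnegativity of the second derivative of [<Ax,x> + <b,x>] at every point
    of the sphere in [D] and in every tangent direction. *)
Definition tangent_inequality A b (D : set 'cV[R]_n) :=
  forall x v, (usphere R n `&` D) x -> enorm v = 1 -> inner x v = 0 ->
    inner b x <= 2 * (inner (A *m v) v - inner (A *m x) x).

Section Convexity.
Variables (K : set 'cV[R]_n) (A : 'M[R]_n) (As : A^T = A).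
Variables (b : 'cV[R]_n) (c : R).
Variables (f : 'cV[R]_n -> R).
Hypothesis fE : forall x, (usphere R n `&` K°) x ->
  f x = inner (A *m x) x + inner b x + c.

(** On a geodesic of speed [s] the second derivative is [s ^+ 2] times the one
    with respect to arc length, which the tangent inequality makes nonnegative. *)
Lemma tangent_inequality_convex : tangent_inequality A b K° ->
  spherically_convex K f.
Proof.
move=> tan J g [Jitv [u [v [a [s [uv s0 gE _]]]]]] gK.
pose F := trig_quad a s (inner (A *m u) u) (2 * inner (A *m u) v)
    (inner (A *m v) v) (inner b u) (inner b v).
have fgE t : J t -> f (g t) = F t + c.
  move=> Jt; rewrite fE; last by apply: gK; exists t.
  by rewrite gE// quadratic_great_circle.
suff main (x y : R) (t : {i01 R}) : J x -> J y -> x <= y ->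
    f (g (conv t (x : R^o) y)) <= conv t (f (g x) : R^o) (f (g y)).
  move=> t x y /set_mem Jx /set_mem Jy.
  have [xy|/ltW yx] := leP x y; first exact: main.
  by rewrite convC [leRHS]convC; exact: main.
move=> Jx Jy xy.
have Jc : J (conv t (x : R^o) y).
  by apply: (Jitv _ _ Jx Jy); have := convR_itv t xy; rewrite in_itv.
rewrite !fgE// -lerBrDr.
apply: le_trans (trig_quad_convex _ _ _ _ _ _ _ _ _ _ _ xy) _; last first.
  rewrite !convRE /unstable.onem -/F; lra.
move=> z xzy; rewrite second_derive_great_circle//.
rewrite mulr_ge0// ?sqr_ge0// subr_ge0.
have Jz : J z by exact: (Jitv _ _ Jx Jy).
apply: tan.
- by rewrite -gE//; apply: gK; exists z.
- exact: enorm_great_circle.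
- exact: inner_great_circle_tangent.
Qed.

(** No derivative is needed here: convexity is used only at the midpoint [x] of
    the arc [- h, h] in the direction [v], where it reads
    [(1 - cos h) * <b,x> <= (1 - cos h) * (1 + cos h) * (<Av,v> - <Ax,x>)].
    Dividing by [1 - cos h] and letting [h] tend to 0 gives the claim. *)
Lemma convex_tangent_inequality : spherically_convex K f ->
  tangent_inequality A b K°.
Proof.
move=> cvx x v [x1 Kx] v1 xv.
have uv : orthonormal_pair x v by [].
set D := inner (A *m v) v - inner (A *m x) x.
have cvgD : (1 + cos h) * D @[h --> (0 : R)^'+] --> 2 * D.
  apply: cvg_at_right_filter; apply: cvgM; last exact: cvg_cst.
  rewrite -[2](_ : 1 + cos 0 = 2); last by rewrite cos0.
  apply: cvgD; [exact: cvg_cst | exact: continuous_cos].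
apply: (cvgr_to_ge cvgD).
have [e /= e0 eK] : nbhs (0 : R) [set t | K° (great_circle x v t)].
  apply: cvg_great_circle0 => //; apply: open_nbhs_nbhs; split=> //.
  exact: open_interior.
near=> h.
have h0 : 0 < h by near: h; exact: nbhs_right_gt.
have he : h < e by near: h; exact: nbhs_right_lt.
have h1 : h < 1 by near: h; exact: nbhs_right_lt.
(* an arc of length at most pi is minimal *)
have hpi : h + h <= pi by apply: le_trans (pi_ge2 R); lra.
pose J : set R := `[- h, h]%classic.
have JE t : J t <-> - h <= t <= h by rewrite /J /= in_itv.
have gK : great_circle x v @` J `<=` usphere R n `&` K°.
  move=> _ [t /= /JE/andP[ht th] <-].
  split; first exact: enorm_great_circle.
  by apply: eK; rewrite /ball_/= sub0r normrN ltr_norml; apply/andP; split; lra.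
have geo : minimal_geodesic J (great_circle x v).
  split; first exact: interval_is_interval.
  exists x, v, 0, 1; split=> //.
    by move=> t _; rewrite add0r mul1r.
  move=> t1 t2 /JE/andP[h1t t1h] /JE/andP[h2t t2h] t12 L.
  rewrite mul1r; apply: great_circle_minimal => //; apply/andP; split; lra.
have [t tE] := @half01 R.
have Jh : J h by apply/JE/andP; split; lra.
have JNh : J (- h) by apply/JE/andP; split; lra.
have J0 : J 0 by apply/JE/andP; split; lra.
have t0 : conv t (- h : R^o) h = 0 by rewrite tE addNr mul0r.
have : f (great_circle x v (conv t (- h : R^o) h)) <=
    conv t (f (great_circle x v (- h)) : R^o) (f (great_circle x v h)).
  exact: cvx geo gK t (- h) h (mem_set JNh) (mem_set Jh).
rewrite t0 tE.
have fgE (r : R) : J r -> f (great_circle x v r) =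
  trig_quad 0 1 (inner (A *m x) x) (2 * inner (A *m x) v)
    (inner (A *m v) v) (inner b x) (inner b v) r + c.
  move=> Jr; rewrite fE; last by apply: gK; exists r.
  by rewrite -quadratic_great_circle// add0r mul1r.
rewrite !fgE// /trig_quad !add0r !mul1r cosN sinN cos0 sin0.
move: (cos2Dsin2 h); rewrite -/(D).
have ch : cos h < 1.
  rewrite -[X in _ < X]cos0 ltr_cos// in_itv/=; apply/andP; split; lra.
move=> cs le.
rewrite -(@ler_pM2l _ (1 - cos h)) ?subr_gt0//.
have s2 : sin h ^+ 2 = 1 - cos h ^+ 2 by rewrite sin2cos2.
rewrite [leRHS](_ : _ = sin h ^+ 2 * D); last by rewrite s2; ring.
have c2 : inner (A *m x) x * (cos h * cos h) =
    inner (A *m x) x * (1 - sin h * sin h) by rewrite -!expr2 cos2sin2.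
by rewrite /D; move: le; lra.
Unshelve. all: by end_near. Qed.

End Convexity.
End Geometry.

(** * Passing to the boundary of the cone *)

Section Limits.
Context {R : realType} {n : nat}.
Implicit Types (x y z u v b : 'cV[R]_n) (k : R) (A : 'M[R]_n).

Lemma cvg_sum_ord {T : Type} {F : set_system T} {FF : Filter F} m
    (f : 'I_m -> T -> R) (l : 'I_m -> R) :
  (forall i, f i t @[t --> F] --> l i) ->
  \sum_i f i t @[t --> F] --> \sum_i l i.
Proof.
by move=> fl; apply: cvg_big => [|i _]; [exact: add_continuous | exact: fl].
Qed.

Lemma cvg_inner {T : Type} {F : set_system T} {FF : Filter F}
    (f g : T -> 'cV[R]_n) x y :
  (forall i, f t i 0 @[t --> F] --> x i 0) ->
  (forall i, g t i 0 @[t --> F] --> y i 0) ->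
  inner (f t) (g t) @[t --> F] --> inner x y.
Proof.
move=> fx gy; rewrite innerE; under eq_fun do rewrite innerE.
by apply: cvg_sum_ord => i; apply: cvgM.
Qed.

Lemma cvg_mulmx_coord {T : Type} {F : set_system T} {FF : Filter F} A
    (f : T -> 'cV[R]_n) x :
  (forall i, f t i 0 @[t --> F] --> x i 0) ->
  forall i, (A *m f t) i 0 @[t --> F] --> (A *m x) i 0.
Proof.
move=> fx i; rewrite mxE; under eq_fun do rewrite mxE.
by apply: cvg_sum_ord => j; apply: cvgM; [exact: cvg_cst|].
Qed.

(** The map [y |-> x + e *: y] is a homeomorphism, so it carries a neighbourhood
    of [p] inside [K] to a neighbourhood of the image of [p], again inside [K]. *)
Lemma interior_affine {K : set 'cV[R]_n} {x p : 'cV[R]_n} {e : R} : 0 < e ->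
  (forall y, K y -> K (x + e *: y)) -> K° p -> K° (x + e *: p).
Proof.
move=> e0 Kxe Kp; pose q : 'cV[R]_n := x + e *: p; rewrite -/q.
have qp : e^-1 *: (q - x) = p.
  by rewrite /q addrC addKr scalerA mulVf ?scale1r// gt_eqF.
have ct : continuous (fun y : 'cV[R]_n => e^-1 *: (y - x)).
  move=> y; have yx : z - x @[z --> y] --> y - x.
    by apply: (@cvgB _ _ _ _ (nbhs_filter y) id (cst x));
      [exact: cvg_id | exact: cvg_cst].
  apply: (@cvgZ R 'cV[R]_n 'cV[R]_n (nbhs y) (nbhs_filter y) (cst e^-1)
    (fun z => z - x)) => //; exact: cvg_cst.
move: (ct q); rewrite /continuous_at.
rewrite qp => /(_ _ Kp) h.
apply: (@filterS _ (nbhs q) (nbhs_filter q) _ _ _ h) => y /= /Kxe.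
by rewrite scalerA divff ?gt_eqF// scale1r addrC subrK.
Qed.

(** A point [x] of [K] is the limit of the interior points [x + e *: p], where
    [p] is interior. The vector [v] need not be orthogonal to these points, so it
    is replaced by a multiple of its orthogonal projection, and the inequality is
    written in the homogeneous form [0 <= G y u], valid for nonzero orthogonal
    [y] and [u] with [y] interior, and continuous in both. *)
Lemma tangent_inequality_closure (K : set 'cV[R]_n) A b : proper_cone K ->
  tangent_inequality A b K° -> tangent_inequality A b K.
Proof.
move=> Kp tan x v [x1 Kx] v1 xv.
have [p intp] := Kp.2.2.2.2.
pose z (e : R) : 'cV[R]_n := x + e *: p.
(* the projection of v onto the orthogonal of z e, times inner (z e) (z e) *)
pose w (e : R) : 'cV[R]_n := inner (z e) (z e) *: v - inner (z e) v *: z e.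
pose G (y u : 'cV[R]_n) :=
  2 * (inner (A *m u) u * inner y y - inner (A *m y) y * inner u u)
  - inner b y * (Num.sqrt (inner y y) * inner u u).
have xx : inner x x = 1 by exact/enorm_eq1.
have vv : inner v v = 1 by exact/enorm_eq1.
have zx i : z e i 0 @[e --> (0 : R)^'+] --> x i 0.
  rewrite [X in _ --> X](_ : _ = x i 0 + 0 * p i 0); last first.
    by rewrite mul0r addr0.
  under eq_fun do rewrite /z 2!mxE.
  apply: cvgD; first exact: cvg_cst.
  by apply: cvgM; [exact: cvg_within | exact: cvg_cst].
have vcst i : v i 0 @[_ --> (0 : R)^'+] --> v i 0 by exact: cvg_cst.
have bcst i : b i 0 @[_ --> (0 : R)^'+] --> b i 0 by exact: cvg_cst.
have zz : inner (z e) (z e) @[e --> (0 : R)^'+] --> inner x x.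
  exact: (cvg_inner _ _ _ _ zx zx).
have zv : inner (z e) v @[e --> (0 : R)^'+] --> inner x v.
  exact: (cvg_inner _ _ _ _ zx vcst).
have wv i : w e i 0 @[e --> (0 : R)^'+] --> v i 0.
  rewrite (_ : v i 0 = inner x x * v i 0 - inner x v * x i 0); last first.
    by rewrite xx xv mul1r mul0r subr0.
  under eq_fun do rewrite /w 2!mxE [X in _ + X]mxE [X in _ - X]mxE.
  by apply: cvgB; apply: cvgM.
have ww : inner (w e) (w e) @[e --> (0 : R)^'+] --> inner v v.
  exact: (cvg_inner _ _ _ _ wv wv).
have Gcvg : G (z e) (w e) @[e --> (0 : R)^'+] --> G x v.
  rewrite /G; apply: cvgB.
    apply: cvgM; first exact: cvg_cst.
    apply: cvgB; apply: cvgM => //.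
      exact: (cvg_inner _ _ _ _ (cvg_mulmx_coord A _ _ wv) wv).
    exact: (cvg_inner _ _ _ _ (cvg_mulmx_coord A _ _ zx) zx).
  apply: cvgM; first exact: (cvg_inner _ _ _ _ bcst zx).
  apply: cvgM => //; apply: (cvg_comp _ _ zz); exact: sqrt_continuous.
suff : 0 <= G x v by rewrite /G xx vv sqrtr1 !mulr1 subr_ge0.
apply: (cvgr_to_ge Gcvg).
have zz0 : \forall e \near (0 : R)^'+, 0 < inner (z e) (z e).
  by apply: (cvgr_gt _ zz); rewrite xx.
have ww0 : \forall e \near (0 : R)^'+, 0 < inner (w e) (w e).
  by apply: (cvgr_gt _ ww); rewrite vv.
near=> e.
have e0 : 0 < e by near: e; exact: nbhs_right_gt.
have ze0 : 0 < inner (z e) (z e) by near: e.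
have we0 : 0 < inner (w e) (w e) by near: e.
have zw : inner (z e) (w e) = 0.
  by rewrite /w innerDr innerNr !innerZr mulrC subrr.
have Kz : K° (z e).
  suff Kxe y : K y -> K (x + e *: y) by exact: (interior_affine e0 Kxe intp).
  by move=> Ky; apply: Kp.2.1 => //; exact: Kp.1.
move: (z e) (w e) ze0 we0 zw Kz => y u y0 u0 yu Ky.
pose r := Num.sqrt (inner y y); pose q := Num.sqrt (inner u u).
have r0 : 0 < r by rewrite sqrtr_gt0.
have q0 : 0 < q by rewrite sqrtr_gt0.
have rr : inner y y = r * r by rewrite -expr2 sqr_sqrtr// ltW.
have qq : inner u u = q * q by rewrite -expr2 sqr_sqrtr// ltW.
have unitV x' t : 0 < t -> inner x' x' = t * t -> enorm (t^-1 *: x') = 1.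
  move=> t0 xt; apply/enorm_eq1; rewrite innerZl innerZr xt.
  by rewrite mulKf ?mulVf// gt_eqF.
have ortho : inner (r^-1 *: y) (q^-1 *: u) = 0.
  by rewrite innerZl innerZr yu !mulr0.
have yr : (usphere R n `&` K°) (r^-1 *: y).
  split; first exact: unitV.
  have ri0 : 0 < r^-1 by rewrite invr_gt0.
  suff Kr y' : K y' -> K (0 + r^-1 *: y').
    by rewrite -[_ *: y]add0r; exact: (interior_affine ri0 Kr Ky).
  by move=> Ky'; rewrite add0r; exact: Kp.1.
have := tan _ _ yr (unitV u q q0 qq) ortho.
rewrite -!scalemxAr !(innerZl, innerZr) /G -/r rr qq.
have rq0 : 0 < (r * r) * (q * q) by rewrite !mulr_gt0.
rewrite -(ler_pM2l rq0) -subr_ge0; congr (0 <= _).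
field; rewrite !gt_eqF//.
Unshelve. all: by end_near. Qed.
End Limits.

(** * Extremal eigenvalues *)

Section Rayleigh.
Context {R : realType} {n : nat}.
Implicit Types (x y z u v b : 'cV[R]_n) (k l : R) (A : 'M[R]_n).

(** The form [l <y,y> - <Ay,y>] is nonnegative and vanishes at [x], so [x] is in
    its kernel: otherwise moving from [x] in the direction [w = l x - A x] would
    make it negative. *)
Lemma rayleigh_extremal_eigen {A : 'M[R]_n} {l x} : A^T = A ->
  (forall y, inner (A *m y) y <= l * inner y y) ->
  inner (A *m x) x = l * inner x x -> A *m x = l *: x.
Proof.
move=> As ub xmax.
have [w wE] : exists w, w = l *: x - A *m x by exists (l *: x - A *m x).
suff w0 : w = 0 by apply/esym/eqP; rewrite -subr_eq0 -wE w0.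
apply: inner_eq0; apply/eqP; rewrite eq_le inner_ge0 andbT leNgt.
apply/negP => W0.
pose W := inner w w; pose Q := l * W - inner (A *m w) w.
have Q0 : 0 <= Q by rewrite subr_ge0; exact: ub.
(* the exact minimizer is - W / Q; the shift by 1 covers the case Q = 0 *)
pose t := - (W / (Q + 1)).
have WE : W = l * inner x w - inner (A *m x) w.
  by rewrite /W {1}wE innerDl innerNl innerZl.
have := ub (x + t *: w).
rewrite mulmxDr -scalemxAr !(innerDl, innerDr, innerZl, innerZr) xmax.
rewrite (inner_mulmx_sym As w x) (innerC w x).
rewrite leNgt => /negP; apply; rewrite -subr_gt0.
have -> : l * inner x x + t * inner (A *m x) w
  + (t * inner (A *m x) w + t * (t * inner (A *m w) w))
  - l * (inner x x + t * inner x w + (t * inner x w + t * (t * inner w w)))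
  = W ^+ 2 * (Q + 2) / (Q + 1) ^+ 2.
  rewrite [LHS](_ : _ = - 2 * t * (l * inner x w - inner (A *m x) w)
    - t ^+ 2 * Q); last first.
    by rewrite /Q /W; ring.
  by rewrite -WE /t; field; rewrite gt_eqF// ltr_wpDl.
have W0' : 0 < W by [].
by rewrite divr_gt0 ?mulr_gt0 ?exprn_gt0//; lra.
Qed.

(** The unit sphere is compact, being closed in a cube. Compactness of cubes
    and the extreme value theorem concern row vectors, hence the transposes. *)
Lemma rayleigh_max_exists A : (0 < n)%N ->
  exists2 x, enorm x = 1 &
    forall y, inner (A *m y) y <= inner (A *m x) x * inner y y.
Proof.
move=> n0.
pose q (r : 'rV[R]_n) := inner (A *m r^T) r^T.
pose S : set 'rV[R]_n := [set r | inner r^T r^T = 1].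
have cvgT (r : 'rV[R]_n) i : s^T i 0 @[s --> r] --> r^T i 0.
  rewrite mxE; under eq_fun do rewrite mxE; exact: coord_continuous.
have qc : continuous q.
  move=> r.
  exact: (cvg_inner _ _ _ _ (cvg_mulmx_coord A _ _ (cvgT r)) (cvgT r)).
have nc : continuous (fun r : 'rV[R]_n => inner r^T r^T).
  by move=> r; exact: (cvg_inner _ _ _ _ (cvgT r) (cvgT r)).
have Sc : compact S.
  apply: (@subclosed_compact _ _
    [set r : 'rV[R]_n | forall i, `[(-1 : R), 1]%classic (r ord0 i)]).
  - rewrite (_ : S = (fun r : 'rV[R]_n => inner r^T r^T) @^-1` [set 1])//.
    by move/continuous_closedP: nc; apply; exact: closed_eq.
  - apply: (@rV_compact _ _ (fun=> `[(-1 : R), 1]%classic)) => i.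
    exact: segment_compact.
  - move=> r /= r1 i; rewrite in_itv/=.
    have := sqr_coord_le r^T i; rewrite r1 mxE => ri.
    by apply/andP; split; nra.
have S0 : S !=set0.
  exists (delta_mx (Ordinal n0) 0)^T; rewrite /S/= trmxK.
  exact/enorm_eq1/enorm_delta.
have [r /set_mem rS rmax] := EVT_max_rV S0 Sc (continuous_subspaceT qc).
exists r^T; first exact/enorm_eq1.
move=> y; have [->|y0] := eqVneq y 0.
  by rewrite mulmx0 {1 3}/inner trmx0 mul0mx mxE mulr0.
pose e := enorm y; have yy := inner_gt0 _ y0.
have e0 : 0 < e by rewrite sqrtr_gt0.
have ye : inner y y = e ^+ 2 by rewrite sqr_sqrtr// ltW.
have yS : (e^-1 *: y)^T \in S.
  by rewrite inE /S/= trmxK; apply/enorm_eq1; exact: normalize_enorm.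
have := rmax _ yS; rewrite /q trmxK -scalemxAr innerZl innerZr => le.
rewrite -ler_pdivrMr// ye; apply: le_trans le; rewrite le_eqVlt.
by apply/orP; left; apply/eqP; field; rewrite gt_eqF.
Qed.

(** The maximum [l] of the Rayleigh quotient is an eigenvalue, its maximizers
    being eigenvectors, and every eigenvalue is a value of the quotient. *)
Lemma lambda_maxP {A} : (0 < n)%N -> A^T = A ->
  [/\ exists2 x, enorm x = 1 & A *m x = lambda_max A *: x
   & forall y, inner (A *m y) y <= lambda_max A * inner y y].
Proof.
move=> n0 As; have [x x1 ub] := rayleigh_max_exists A n0.
have xx : inner x x = 1 by exact/enorm_eq1.
set l := inner (A *m x) x in ub.
have Ax : A *m x = l *: x.
  by apply: rayleigh_extremal_eigen => //; rewrite xx mulr1.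
suff -> : lambda_max A = l by split=> //; exists x.
have xl : [set l | eigenvalue A l] l.
  apply/eigenvalueP; exists x^T; first by rewrite -{1}As -trmx_mul Ax linearZ.
  rewrite trmx_eq0; apply: contra_eq_neq xx => ->.
  by rewrite inner0l eq_sym oner_eq0.
have ubl : ubound [set l | eigenvalue A l] l.
  move=> m /= /eigenvalueP[r rA r0].
  have := ub r^T; rewrite -{1}As -trmx_mul rA linearZ /= innerZl ler_pM2r//.
  by apply: inner_gt0; rewrite trmx_eq0.
apply/eqP; rewrite eq_le; apply/andP; split.
  by apply: ge_sup => //; exists l.
by apply: ub_le_sup => //; exists l.
Qed.

Lemma lambda_minE A : lambda_min A = - lambda_max (- A).
Proof.
rewrite /lambda_min /lambda_max /inf; congr (- sup _).
have eN (B : 'M[R]_n) l : eigenvalue B l -> eigenvalue (- B) (- l).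
  move=> /eigenvalueP[v vB v0]; apply/eigenvalueP; exists v => //.
  by rewrite mulmxN vB scaleNr.
apply/seteqP; split=> [_ [l /= Al <-]|l /= Al]; first exact: eN.
by exists (- l); [rewrite /= -[A]opprK; exact: eN | rewrite opprK].
Qed.

Lemma lambda_minP {A} : (0 < n)%N -> A^T = A ->
  [/\ exists2 x, enorm x = 1 & A *m x = lambda_min A *: x
   & forall y, lambda_min A * inner y y <= inner (A *m y) y].
Proof.
move=> n0 As; have NAs : (- A)^T = - A by rewrite linearN /= As.
have [[x x1 Ax] ub] := lambda_maxP n0 NAs.
rewrite lambda_minE; split.
  by exists x => //; rewrite scaleNr -Ax mulNmx opprK.
by move=> y; have := ub y; rewrite mulNmx innerNl; lra.
Qed.
End Rayleigh.

(** * Consequences of the tangent inequality *)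

Section Consequences.
Context {R : realType} {n : nat} {K : set 'cV[R]_n}.
Context {A : 'M[R]_n} {b : 'cV[R]_n}.
Hypothesis As : A^T = A.

Lemma tangent_inequality_sum x y : tangent_inequality A b K ->
  (usphere R n `&` K) x -> (usphere R n `&` K) y -> inner x y = 0 ->
  inner b (x + y) <= 0.
Proof.
move=> tan Kx Ky xy; have h1 := tan x y Kx Ky.1 xy.
have h2 := tan y x Ky Kx.1 (etrans (innerC y x) xy).
rewrite innerDr; move: h1 h2; lra.
Qed.

(** The point [(x + y) / sqrt 2] stays in the convex cone [K], and the
    difference of the values of the quadratic form at [(x - y) / sqrt 2] and at
    this point is [- 2 <Ax,y>]. *)
Lemma tangent_inequality_diagonal x y : proper_cone K ->
  tangent_inequality A b K ->
  (usphere R n `&` K) x -> (usphere R n `&` K) y -> inner x y = 0 ->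
  inner b (x + y) <= - (4 * Num.sqrt 2) * inner (A *m x) y.
Proof.
move=> Kp tan [x1 Kx] [y1 Ky] xy.
have xx : inner x x = 1 by exact/enorm_eq1.
have yy : inner y y = 1 by exact/enorm_eq1.
have yx : inner y x = 0 by rewrite innerC.
pose r : R := Num.sqrt 2.
have r0 : 0 < r by rewrite sqrtr_gt0.
have rr : r * r = 2 by rewrite -expr2 sqr_sqrtr.
have rV : r^-1 * r^-1 = 2^-1 by rewrite -invfM rr.
have innerE' := (@innerDl R n, @innerDr R n, @innerNl R n, @innerNr R n,
  @innerZl R n, @innerZr R n).
have pS : (usphere R n `&` K) (r^-1 *: (x + y)).
  split; last by apply: Kp.1; [exact: Kp.2.1 | rewrite invr_gt0].
  by apply/enorm_eq1; rewrite !innerE' xx yy yx xy; move: rV; lra.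
have v1 : enorm (r^-1 *: (x - y)) = 1.
  by apply/enorm_eq1; rewrite !innerE' xx yy yx xy; move: rV; lra.
have pv : inner (r^-1 *: (x + y)) (r^-1 *: (x - y)) = 0.
  by rewrite !innerE' xx yy yx xy; lra.
have := tan _ _ pS v1 pv.
rewrite -!scalemxAr !mulmxDr mulmxN !innerE' (inner_mulmx_sym As y x).
set p := inner (A *m x) x; set q := inner (A *m x) y; set s := inner (A *m y) y.
have -> : 2 * (r^-1 * (r^-1 * (p - q) - r^-1 * (q - s))
    - r^-1 * (r^-1 * (p + q) + r^-1 * (q + s))) = r^-1 * r^-1 * (- 8 * q).
  by ring.
by rewrite rV -(ler_pM2l r0) mulrA divff ?gt_eqF// mul1r -/r; lra.
Qed.

(** The vector of absolute values of a top eigenvector is again a top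
    eigenvector, since its Rayleigh quotient can only be larger. It lies in the
    orthant, and it is orthogonal to the eigenvectors of [lambda_min A] as soon
    as the two eigenvalues differ. *)
Lemma tangent_inequality_spectral_gap : (0 < n)%N ->
  (forall i j, 0 <= A i j) -> orthant R n `<=` K -> tangent_inequality A b K ->
  2 * (lambda_max A - lambda_min A) <= enorm (neg_part_vec b).
Proof.
move=> n0 Age0 oK tan.
have [[w w1 Aw] _] := lambda_minP n0 As.
have [[u u1 Au] lmax] := lambda_maxP n0 As.
have uu : inner u u = 1 by exact/enorm_eq1.
have ww : inner w w = 1 by exact/enorm_eq1.
set m := lambda_min A in Aw *; set M := lambda_max A in lmax Au *.
have [->|mM] := eqVneq m M; first by rewrite subrr mulr0 sqrtr_ge0.
pose x : 'cV[R]_n := \col_i `|u i 0|.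
have x1 : enorm x = 1.
  apply/enorm_eq1; rewrite -uu !innerE; apply: eq_bigr => i _.
  by rewrite mxE -normrM ger0_norm// -expr2 sqr_ge0.
have xx : inner x x = 1 by exact/enorm_eq1.
have Ax : A *m x = M *: x.
  apply: rayleigh_extremal_eigen => //.
  apply/eqP; rewrite eq_le lmax/= xx mulr1.
  have -> : M = inner (A *m u) u by rewrite Au innerZl uu mulr1.
  rewrite !innerE; apply: ler_sum => i _; rewrite !mxE !mulr_suml.
  apply: ler_sum => j _; rewrite !mxE -!mulrA ler_wpM2l// -normrM.
  exact: ler_norm.
have xw : inner x w = 0.
  have := inner_mulmx_sym As x w; rewrite Ax Aw !innerZl (innerC w x).
  move/eqP; rewrite -subr_eq0 -mulrBl mulf_eq0 subr_eq0 eq_sym (negbTE mM).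
  by move/eqP.
have Kx : (usphere R n `&` K) x.
  by split=> //; apply: oK => i; rewrite mxE normr_ge0.
have := tan _ _ Kx w1 xw; rewrite Ax Aw !innerZl xx ww !mulr1.
have := inner_le_enorm _ (neg_part_vec b) x1.
have : - inner (neg_part_vec b) x <= inner b x.
  rewrite -innerNl !innerE; apply: ler_sum => i _; rewrite !mxE.
  by rewrite ler_wpM2r// lerNl le_max lexx.
lra.
Qed.

(** The coordinates of [x] lie between 0 and 1, so their sum is at least the sum
    of their squares, which is 1. *)
Lemma spectral_gap_tangent_inequality : (0 < n)%N -> K `<=` orthant R n ->
  (forall i, b i 0 <= 2 * Num.sqrt n%:R * (lambda_min A - lambda_max A)) ->
  tangent_inequality A b K.
Proof.
move=> n0 Ko bi x v [x1 /Ko xo] v1 xv.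
have [_ lmin] := lambda_minP n0 As.
have [[u u1 Au] lmax] := lambda_maxP n0 As.
have uu : inner u u = 1 by exact/enorm_eq1.
have xx : inner x x = 1 by exact/enorm_eq1.
have vv : inner v v = 1 by exact/enorm_eq1.
set m := lambda_min A in bi lmin; set M := lambda_max A in bi lmax Au.
have mM : m <= M by have := lmin u; rewrite Au innerZl uu !mulr1.
have := lmin v; have := lmax x; rewrite xx vv !mulr1 => hx hv.
suff : inner b x <= 2 * (m - M) by lra.
have sum1 : 1 <= \sum_i x i 0.
  rewrite -xx innerE; apply: ler_sum => i _; rewrite ler_piMr//.
  by have := sqr_coord_le x i; rewrite xx; have := xo i; nra.
have sqn : 1 <= Num.sqrt n%:R :> R.
  by rewrite -[leLHS]sqrtr1 ler_wsqrtr// ler1n.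
apply: (@le_trans _ _ ((2 * Num.sqrt n%:R * (m - M)) * \sum_i x i 0)).
  by rewrite innerE mulr_sumr; apply: ler_sum => i _; rewrite ler_wpM2r.
have : 1 <= Num.sqrt n%:R * \sum_i x i 0 by rewrite mulr_ege1.
nra.
Qed.

End Consequences.

Theorem theorem1 (R : realType) (n : nat) (n_ge3 : (3 <= n)%N)
    (K : set 'cV[R]_n) (K_proper : proper_cone K)
    (A : 'M[R]_n) (A_sym : A^T = A) (b : 'cV[R]_n) (c : R)
    (f : 'cV[R]_n -> R)
    (f_def : forall x, (usphere R n `&` K°) x ->
       f x = inner (A *m x) x + inner b x + c) :
  (* (i) *)
  (A = 0 -> (spherically_convex K f <-> polar_cone K b)) /\
  (* (ii) *)
  (dual_cone K `<=` K -> spherically_convex K f ->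
     (forall x y, (usphere R n `&` K) x -> (usphere R n `&` K) y ->
        inner x y = 0 ->
        inner (A *m x) y <= - (Num.sqrt 2 / 8) * inner b (x + y)) /\
     (K = orthant R n ->
        forall i j : 'I_n, i != j ->
          A i j <= - (Num.sqrt 2 / 8) * (b i 0 + b j 0))) /\
  (* (iii) *)
  (spherically_convex K f ->
     (forall x y, (usphere R n `&` K) x -> (usphere R n `&` K) y ->
        inner x y = 0 -> inner b (x + y) <= 0) /\
     (orthant R n `<=` K ->
        (forall i j : 'I_n, i != j -> b i 0 + b j 0 <= 0) /\
        (\big[maxe/-oo]_(j in ~: argmin_diag A) (b j 0 + A j j)%:E
           <= \big[mine/+oo]_i (A i i)%:E)%E)) /\
  (* (iv) *)
  (spherically_convex K f ->
     (forall x y, (usphere R n `&` K) x -> (usphere R n `&` K) y ->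
        inner x y = 0 ->
        inner b (x + y) <= - (4 * Num.sqrt 2) * pos_part (inner (A *m x) y)) /\
     (K = orthant R n ->
        forall i j : 'I_n, i != j ->
          b i 0 + b j 0 <= - (4 * Num.sqrt 2) * pos_part (A i j))) /\
  (* (v) *)
  (K = orthant R n -> (forall i j, 0 < A i j) -> spherically_convex K f ->
     2 * (lambda_max A - lambda_min A) <= enorm (neg_part_vec b)) /\
  (* (vi) *)
  (K `<=` orthant R n ->
     (forall i, b i 0 <= 2 * Num.sqrt n%:R * (lambda_min A - lambda_max A)) ->
     spherically_convex K f).
Proof.
have n0 : (0 < n)%N by exact: leq_trans n_ge3.
have cvxP : spherically_convex K f -> tangent_inequality A b K.
  move=> cvx; apply: tangent_inequality_closure => //.
  exact: (convex_tangent_inequality K A A_sym b c f f_def cvx).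
have cvxI : tangent_inequality A b K -> spherically_convex K f.
  move=> tan; apply: (tangent_inequality_convex K A A_sym b c f f_def).
  by move=> x v [x1 Kx]; apply: tan; split=> //; exact: interior_subset.
have e0 (i j : 'I_n) : i != j ->
    inner (delta_mx i 0 : 'cV[R]_n) (delta_mx j 0) = 0.
  by move=> ij; rewrite inner_delta mxE (eq_sym j) (negbTE ij).
have eK (i : 'I_n) : orthant R n `<=` K ->
    (usphere R n `&` K) (delta_mx i 0).
  move=> oK; split; first exact: enorm_delta.
  by apply: oK => j; rewrite mxE ler0n.
have eA (i j : 'I_n) : inner (A *m delta_mx i 0) (delta_mx j 0) = A i j.
  by rewrite inner_delta -colE mxE -{1}A_sym mxE.
have eb (i j : 'I_n) :
    inner b (delta_mx i 0 + delta_mx j 0) = b i 0 + b j 0.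
  by rewrite innerDr !inner_delta.
have iii x y : spherically_convex K f ->
    (usphere R n `&` K) x -> (usphere R n `&` K) y -> inner x y = 0 ->
    inner b (x + y) <= 0.
  by move=> /cvxP; exact: tangent_inequality_sum.
have iv x y : spherically_convex K f ->
    (usphere R n `&` K) x -> (usphere R n `&` K) y -> inner x y = 0 ->
    inner b (x + y) <= - (4 * Num.sqrt 2) * inner (A *m x) y.
  by move=> /cvxP; exact: tangent_inequality_diagonal.
split.
  move=> A0; split=> [/cvxP tan y Ky|bK]; last first.
    apply: cvxI => x v [_ Kx] _ _.
    by rewrite A0 !mul0mx !inner0l subrr mulr0; exact: bK.
  have [->|y0] := eqVneq y 0; first by rewrite innerC inner0l.
  have ny : 0 < enorm y by rewrite sqrtr_gt0; exact: inner_gt0.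
  have x1 := normalize_enorm _ y0.
  have [v v1 xv] := exists_unit_orthogonal _ (ltnW n_ge3) x1.
  have Kx : K ((enorm y)^-1 *: y) by apply: K_proper.1 => //; rewrite invr_gt0.
  have := tan _ v (conj x1 Kx) v1 xv.
  rewrite A0 !mul0mx !inner0l subrr mulr0 innerZr.
  by rewrite pmulr_rle0// invr_gt0.
split.
  move=> _ cvx.
  have ii x y : (usphere R n `&` K) x -> (usphere R n `&` K) y ->
      inner x y = 0 -> inner (A *m x) y <= - (Num.sqrt 2 / 8) * inner b (x + y).
    move=> Kx Ky xy; have := iv x y cvx Kx Ky xy.
    have s0 : 0 <= Num.sqrt 2 / 8 :> R by rewrite divr_ge0.
    move=> /(ler_wpM2l s0).
    have -> z : Num.sqrt 2 / 8 * (- (4 * Num.sqrt 2) * z) = - z :> R.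
      have ss : Num.sqrt 2 * Num.sqrt 2 = 2 :> R by rewrite -expr2 sqr_sqrtr.
      transitivity (- (Num.sqrt 2 * Num.sqrt 2) / 2 * z); first by field.
      by rewrite ss; field.
    lra.
  split=> // KE i j ij; rewrite -eb -eA.
  by apply: ii; [apply: eK; rewrite KE|apply: eK; rewrite KE|exact: e0].
split.
  move=> cvx; split=> [x y|oK]; first exact: iii.
  have bij i j : i != j -> b i 0 + b j 0 <= 0.
    move=> ij; rewrite -eb.
    by apply: iii => //; [exact: eK|exact: eK|exact: e0].
  split=> //.
  have bd i j : i != j -> b j 0 <= 2 * (A i i - A j j).
    move=> ij; have := cvxP cvx _ _ (eK j oK) (enorm_delta i).
    by rewrite e0 1?eq_sym// => /(_ erefl); rewrite !eA inner_delta.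
  apply/bigmax_leP; split=> [|j]; first exact: leNye.
  (* a smaller diagonal entry A k k forces b j 0 < 0, so that b j 0 is at most
     half of itself, the quantity bounded by bd *)
  rewrite !inE negb_forall => /existsP[k]; rewrite -ltNge => kj.
  have kj' : k != j by apply: contraTneq kj => ->; rewrite ltxx.
  apply/bigmin_geP; split=> [|i _]; first exact: leey.
  rewrite lee_fin; have := bd k j kj'.
  have [->|ij] := eqVneq i j; first by lra.
  by have := bd i j ij; lra.
split.
  move=> cvx.
  have iv' x y : (usphere R n `&` K) x -> (usphere R n `&` K) y ->
      inner x y = 0 ->
      inner b (x + y) <= - (4 * Num.sqrt 2) * pos_part (inner (A *m x) y).
    move=> Kx Ky xy; rewrite /pos_part.
    case: (leP (inner (A *m x) y) 0) => _; last exact: iv.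
    by rewrite mulr0; exact: iii.
  split=> // KE i j ij; rewrite -eb -eA.
  by apply: iv'; [apply: eK; rewrite KE|apply: eK; rewrite KE|exact: e0].
split.
  move=> KE Apos /cvxP tan.
  apply: (tangent_inequality_spectral_gap A_sym n0 _ _ tan) => [i j|].
    exact: ltW.
  by rewrite KE.
move=> Ko bi; apply: cvxI.
exact: (spectral_gap_tangent_inequality A_sym n0 Ko bi).
Qed.
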